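(* Let $\mathcal{A}$ be a finite alphabet. Every path set $\mathcal{P}\subseteq\mathcal{A}^{\mathbb{N}}$ has a right-resolving presentation that is reachable; that is, there is a pointed graph $(\mathcal{G},v)$ over $\mathcal{A}$ with $X_{\mathcal{G}}(v)=\mathcal{P}$ such that $\mathcal{G}$ is right-resolving and each vertex of $\mathcal{G}$ can be reached from $v$ by a directed path.
   Context: $\mathcal{A}^{\mathbb{N}}$ is the set of one-sided infinite sequences $a_0a_1a_2\cdots$ with $a_i\in\mathcal{A}$. A labeled directed graph over $\mathcal{A}$ is a finite directed graph $\mathcal{G}$ whose edges carry labels from $\mathcal{A}$; loops and multiple edges are allowed, but the triples (initial vertex, terminal vertex, label) are required to be distinct. A pointed graph $(\mathcal{G},v)$ is such a graph with a distinguished vertex $v$. The path set $X_{\mathcal{G}}(v)$ is the set of all sequences of successive edge labels of one-sided infinite walks in $\mathcal{G}$ starting at $v$; a subset $\mathcal{P}\subseteq\mathcal{A}^{\mathbb{N}}$ is a path set if $\mathcal{P}=X_{\mathcal{G}}(v)$ for some pointed graph $(\mathcal{G},v)$ over $\mathcal{A}$, which is then called a presentation of $\mathcal{P}$. $\mathcal{G}$ is right-resolving if for every vertex $w$ of $\mathcal{G}$ there is at most one edge originating at $w$ with any given label. Directed paths of length $0$ are allowed in the definition of reachability. *)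

(* Defs.v *)
From mathcomp Require Import all_boot.
From mathcomp Require Import classical_sets.

Set Implicit Arguments.
Unset Strict Implicit.
Unset Printing Implicit Defensive.

Local Open Scope classical_set_scope.

(* An edge is identified with its triple (initial vertex, terminal vertex,
   label), since these triples are required to be distinct. *)
Record labeled_graph (A : finType) := LabeledGraph {
  vertex :> finType;
  edges : {set vertex * vertex * A}
}.

Section LabeledGraphs.
Variable A : finType.
Implicit Type G : labeled_graph A.

Definition initial G (e : G * G * A) : G := e.1.1.
Definition terminal G (e : G * G * A) : G := e.1.2.
Definition label G (e : G * G * A) : A := e.2.

Definition infinite_walk G (v : G) (e : nat -> G * G * A) : Prop :=
  [/\ initial (e 0) = v,
      forall n, e n \in edges G
    & forall n, terminal (e n) = initial (e n.+1)].

Definition X G (v : G) : set (nat -> A) :=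
  [set x | exists2 e : nat -> G * G * A,
             infinite_walk v e & forall n, x n = label (e n)].

Definition presents G (v : G) (P : set (nat -> A)) : Prop := X v = P.

Definition path_set (P : set (nat -> A)) : Prop :=
  exists (G : labeled_graph A) (v : G), presents v P.

Definition right_resolving G : Prop :=
  forall e e', e \in edges G -> e' \in edges G ->
    initial e = initial e' -> label e = label e' -> e = e'.

Definition adjacent G : rel G :=
  fun u w => [exists a : A, (u, w, a) \in edges G].

Definition reachable G (v : G) : Prop :=
  forall w : G, connect (@adjacent G) v w.

End LabeledGraphs.

(* Main.v *)
Require Import Defs.
From mathcomp Require Import all_boot.
From mathcomp Require Import boolp classical_sets finset.

(** The subset construction determinizes a presentation: from a set [S] of
    vertices, the letter [a] leads to the set of all [a]-successors of [S],
    provided that it is nonempty.  A sequence that can be read in the subset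
    graph has all its prefixes readable in the original graph from [v]; since
    the graph is finite, Koenig's lemma turns this into one infinite walk.
    Finally, one keeps only the vertices reachable from the base vertex. *)

Set Implicit Arguments.
Unset Strict Implicit.
Unset Printing Implicit Defensive.

Section ReachablePart.
Variables (A : finType) (G : labeled_graph A) (v : G).

Definition reachable_vertex := {w : G | connect (@adjacent A G) v w}.

Definition reachable_part : labeled_graph A :=
  @LabeledGraph A reachable_vertex
    [set e | (val e.1.1, val e.1.2, e.2) \in edges G].

Definition reachable_root : reachable_part := Sub v (connect0 _ v).

Lemma reachable_part_right_resolving :
  right_resolving G -> right_resolving reachable_part.
Proof.
move=> rrG [[u w] a] [[u' w'] a']; rewrite !inE /= => uwE uwE'.
rewrite /initial /label /= => eq_u eq_a.
move: uwE'; rewrite -eq_u -eq_a => uwE'.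
by have [/val_inj ->] := rrG _ _ uwE uwE' erefl erefl.
Qed.

(** A path of [G] that starts at a reachable vertex meets only reachable vertices, so it lifts step
    by step to the subtype. *)
Lemma reachable_part_reachable : reachable reachable_root.
Proof.
have lift p (u w : reachable_part) :
    path (@adjacent A G) (val u) p -> val w = last (val u) p ->
    connect (@adjacent A reachable_part) u w.
  elim: p u => [|t p IHp] u /=; first by move=> _ /val_inj ->.
  case/andP=> ut pt eq_w.
  pose t' : reachable_part :=
    Sub t (connect_trans (valP u) (connect1 ut)).
  apply: (@connect_trans _ _ t'); last exact: IHp.
  apply: connect1; case/existsP: (ut) => a uat.
  by apply/existsP; exists a; rewrite inE.
by move=> w; have /connectP[p vp eq_w] := valP w; exact: (lift p reachable_root).
Qed.

(** An infinite walk from [v] never leaves the set of vertices reachable from [v]. *)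
Lemma X_reachable_part : X reachable_root = X v.
Proof.
apply/seteqP; split=> x [e [e0 eE eS] xe].
  exists (fun n => (val (e n).1.1, val (e n).1.2, (e n).2)) => //.
  split; first by move: e0; rewrite /initial => ->.
    by move=> n; have := eE n; rewrite inE.
  by move=> n; have := eS n; rewrite /terminal /initial /= => ->.
have re n : connect (@adjacent A G) v (initial (e n)).
  elim: n => [|n IHn]; first by rewrite e0.
  rewrite -eS; apply: (connect_trans IHn); apply: connect1.
  apply/existsP; exists (label (e n)); have := eE n.
  by rewrite /initial /terminal /label; case: (e n) => [[]].
pose w n : reachable_part := Sub (initial (e n)) (re n).
exists (fun n => (w n, w n.+1, x n)) => //; split=> // [|n].
  exact/val_inj.
rewrite inE /= -eS xe; have := eE n.
by rewrite /initial /terminal /label; case: (e n) => [[]].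
Qed.

End ReachablePart.

Section SubsetConstruction.
Variables (A : finType) (G : labeled_graph A).
Implicit Types (S T : {set G}) (u w : G) (a : A) (s : seq A) (x : nat -> A).

Definition successors S a : {set G} :=
  [set w | [exists u in S, (u, w, a) \in edges G]].

Definition run S s : {set G} := foldl successors S s.

Definition word x n m : seq A := [seq x i | i <- iota n m].

Lemma successorsP S a w :
  reflect (exists2 u, u \in S & (u, w, a) \in edges G) (w \in successors S a).
Proof. by rewrite inE; apply: exists_inP. Qed.

Lemma run0 s : run set0 s = set0.
Proof.
elim: s => //= a s IHs; suff -> : successors set0 a = set0 by [].
by apply/setP=> w; rewrite in_set0; apply/successorsP => -[u]; rewrite inE.
Qed.

Lemma run_cat S s s' : run S (s ++ s') = run (run S s) s'.
Proof. exact: foldl_cat. Qed.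

Lemma run_rcons S s a : run S (rcons s a) = successors (run S s) a.
Proof. exact: foldl_rcons. Qed.

Lemma word_cat x n m p : word x n (m + p) = word x n m ++ word x (n + m) p.
Proof. by rewrite /word iotaD map_cat. Qed.

Lemma word_rcons x n m : word x n m.+1 = rcons (word x n m) (x (n + m)).
Proof. by rewrite -addn1 word_cat cats1. Qed.

Lemma run_from_point S s w :
  w \in run S s -> exists2 u, u \in S & w \in run [set u] s.
Proof.
elim/last_ind: s w => [|s a IHs] w.
  by move=> wS; exists w; rewrite //= set11.
rewrite run_rcons => /successorsP[t /IHs[u uS ut] twE].
by exists u; rewrite // run_rcons; apply/successorsP; exists t.
Qed.

(** The finitary hypothesis of Koenig's lemma: each finite stretch of [x] from position [n] on can
    be read from some point of [S], possibly a different one for each length. *)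
Definition extendable x n S := forall m, run S (word x n m) != set0.

(* A finite set of dead points is dead after the maximum of their times of
   death. *)
Lemma extendable_point x n S :
  extendable x n S -> exists2 u, u \in S & extendable x n [set u].
Proof.
move=> extS; apply: contrapT => noext.
have /choice[d dP] u : exists m, u \in S -> run [set u] (word x n m) = set0.
  case: (pselect (exists m, run [set u] (word x n m) = set0)) => [[m]|nd].
    by exists m.
  (* The value 0 is a dummy: a point that never dies cannot lie in [S], by [noext]. *)
  exists 0 => uS; case: noext; exists u => // m.
  by apply/eqP => dead; apply: nd; exists m.
have /set0Pn[w /run_from_point[u uS]] := extS (\max_u d u).
by rewrite -(subnKC (leq_bigmax u)) word_cat run_cat dP // run0 inE.
Qed.

(** The inductive step of Koenig's lemma: reading [x n] leaves an extendable set of successors, and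
    [extendable_point] picks one of them. *)
Lemma extendable_succ x n u : extendable x n [set u] ->
  exists2 w, (u, w, x n) \in edges G & extendable x n.+1 [set w].
Proof.
move=> extu.
have [w /successorsP[t /set1P-> uwE] extw] :
    exists2 w, w \in successors [set u] (x n) & extendable x n.+1 [set w].
  by apply: extendable_point => m; apply: (extu m.+1).
by exists w.
Qed.

Lemma X_extendable v x : X v x <-> extendable x 0 [set v].
Proof.
split=> [[e [e0 eE eS] xe] m | extv].
  apply/set0Pn; exists (initial (e m)).
  elim: m => [|m IHm]; first by rewrite e0 /= set11.
  rewrite word_rcons run_rcons; apply/successorsP.
  exists (initial (e m)) => //; rewrite add0n -eS xe; have := eE m.
  by rewrite /initial /terminal /label; case: (e m) => [[]].
(* The next vertex is chosen for all pairs (position, vertex) at once, so that iterating [f] from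
   [v] gives the walk; at pairs that are not extendable the choice is arbitrary. *)
have /choice[f fP] (p : nat * G) : exists w, extendable x p.1 [set p.2] ->
    (p.2, w, x p.1) \in edges G /\ extendable x p.1.+1 [set w].
  have [/extendable_succ[w pw extw]|nextp] :=
    pselect (extendable x p.1 [set p.2]); first by exists w.
  by exists p.2.
pose w := fix w n := if n is m.+1 then f (m, w m) else v.
have extw n : extendable x n [set w n].
  by elim: n => //= n /(fP (n, w n))[].
exists (fun n => (w n, w n.+1, x n)) => //; split=> // n.
by have [] := fP (n, w n) (extw n).
Qed.

(** Excluding [set0] as a target is essential: with a loop there for every letter, every sequence
    could be read. *)
Definition subset_graph : labeled_graph A :=
  @LabeledGraph A {set G}
    [set e | (e.1.2 == successors e.1.1 e.2) && (e.1.2 != set0)].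

Lemma subset_graph_right_resolving : right_resolving subset_graph.
Proof.
move=> [[S T] a] [[S' T'] a']; rewrite !inE /=.
move=> /andP[/eqP-> _] /andP[/eqP-> _].
by rewrite /initial /label /= => -> ->.
Qed.

Lemma X_subset_graph (v : G) : X ([set v] : subset_graph) = X v.
Proof.
apply/seteqP; split=> x; last first.
  move=> /X_extendable extv.
  exists (fun n => (run [set v] (word x 0 n), run [set v] (word x 0 n.+1), x n))
    => //.
  split=> // n; rewrite inE; apply/andP; split; last exact: extv.
  by apply/eqP; rewrite -run_rcons -word_rcons.
move=> [e [e0 eE eS] xe]; apply/X_extendable => m.
(* The walk is forced by its labels: its vertex at time [m] is the run of the prefix of length
   [m]. *)
have -> : run [set v] (word x 0 m) = initial (e m).
  elim: m => [|m IHm]; first by rewrite e0.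
  rewrite word_rcons run_rcons IHm add0n xe -eS.
  by have := eE m; rewrite inE => /andP[/eqP].
(* At time 0 the set contains [v]; at any later time it is the target of an edge, hence nonempty. *)
case: m => [|m].
  by rewrite e0; apply/set0Pn; exists v; rewrite set11.
by rewrite -eS; have := eE m; rewrite inE => /andP[].
Qed.

End SubsetConstruction.

Theorem theorem3p2 (A : finType) (P : set (nat -> A)) (hP : path_set P) :
  exists (G : labeled_graph A) (v : G),
    [/\ presents v P, right_resolving G & reachable v].
Proof.
have [G [v vP]] := hP; pose S0 : subset_graph G := [set v].
exists (reachable_part S0), (reachable_root S0); split.
- by rewrite /presents X_reachable_part X_subset_graph.
- exact/reachable_part_right_resolving/subset_graph_right_resolving.
- exact: reachable_part_reachable.
Qed.
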